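(* Suppose $n$ is a positive integer such that every angle $\alpha$ is $n$-sectable, i.e. for any angle $\alpha$ there exists a Euclidean (straightedge and compass) construction that starts with $\alpha$ and produces $\alpha/n$. Then $n$ has the form $2^k$ for some non-negative integer $k$.
   Context: Let $S\subseteq\mathbb{R}^2$ contain $(0,0)$ and $(1,0)$. A point is constructible over $S$ if it can be obtained from points of $S$ by a finite sequence of straightedge-and-compass steps: (1) given two distinct points already available, one may draw the line through them, or the circle centered at one of them and passing through the other; (2) given two lines, two circles, or a line and a circle already drawn, one may add their intersection points. $C(S)$ denotes the set of all points constructible over $S$. An angle is given by its radian measure $\alpha\in\mathbb{R}$ and is represented by the point $(\cos\alpha,\sin\alpha)$ of the unit circle. The angle $\alpha$ is $n$-sectable if $(\cos(\alpha/n),\sin(\alpha/n))\in C(\{(0,0),(1,0),(\cos\alpha,\sin\alpha)\})$. *)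

(* Defs.v *)
From HB Require Import structures.
From mathcomp Require Import all_boot all_order all_algebra.
From mathcomp Require Import boolp classical_sets reals trigo.

Set Implicit Arguments.
Unset Strict Implicit.
Unset Printing Implicit Defensive.

Import Order.TTheory GRing.Theory Num.Theory.
Local Open Scope classical_set_scope.
Local Open Scope ring_scope.

Section Constructible.
Context {R : realType}.
Local Notation point := (R * R)%type.

Definition sqdist (p q : point) : R :=
  (p.1 - q.1) ^+ 2 + (p.2 - q.2) ^+ 2.

Definition line_through (p q : point) : set point :=
  [set x | exists t : R,
     x = (p.1 + t * (q.1 - p.1), p.2 + t * (q.2 - p.2))].

Definition circle_centered (c q : point) : set point :=
  [set x | sqdist c x = sqdist c q].

(* [constructible S] is C(S).  Lines and circles are identified with their
   sets of points.  The condition [A <> B] is needed in [constructible_meet]: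
   otherwise every point of a drawn curve would be constructible, as an
   intersection point of that curve with itself. *)
Inductive constructible (S : set point) : point -> Prop :=
| constructible_base (p : point) : S p -> constructible S p
| constructible_meet (A B : set point) (p : point) :
    drawn S A -> drawn S B -> A <> B -> A p -> B p -> constructible S p
with drawn (S : set point) : set point -> Prop :=
| drawn_line (p q : point) :
    constructible S p -> constructible S q -> p <> q ->
    drawn S (line_through p q)
| drawn_circle (c q : point) :
    constructible S c -> constructible S q -> c <> q ->
    drawn S (circle_centered c q).

Definition angle_point (alpha : R) : point := (cos alpha, sin alpha).

Definition sectable (n : nat) (alpha : R) : Prop :=
  constructible [set (0, 0); (1, 0); angle_point alpha]
    (angle_point (alpha / n%:R)).

End Constructible.

(* Main.v *)
(** Since [2 pi] and [2 pi / n] are [n]-sectable, the cosine and sine of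
    [2 pi / n ^ 2] arise from rational numbers by field operations and square
    roots.  Hence a primitive [n ^ 2]-th root of unity lies in an extension of
    the rationals of degree [2 ^ m], and its own degree [totient (n ^ 2)], which
    is a multiple of [n], divides [2 ^ m]. *)
Require Import Defs.
From HB Require Import structures.
From mathcomp Require Import all_boot all_order all_algebra all_field.
From mathcomp Require Import boolp classical_sets reals trigo.
From mathcomp Require Import complex ring lra zify.

Set Implicit Arguments.
Unset Strict Implicit.
Unset Printing Implicit Defensive.

Import Order.TTheory GRing.Theory Num.Theory.
Local Open Scope ring_scope.

(** * Degrees in towers and irreducible quadratics *)

Lemma dim_baseFieldType (F0 : fieldType) (F : fieldExtType F0) (L : fieldExtType F) :
  \dim {:baseFieldType L} = (\dim {:L} * \dim {:F})%N.
Proof.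
rewrite -dim_baseVspace; congr (\dim _).
apply/vspaceP => y.
by rewrite (mem_baseVspace fullv y) (memvf (y : L)) (memvf (y : baseFieldType L)).
Qed.

(** A reducible quadratic has a root [y], and then [f y] is [x] or [- x]; either way [x] lies in the
    image of [f]. *)
Lemma irreducible_sqr_sub (F E : fieldType) (f : {rmorphism F -> E}) (a : F) (x : E) :
  f a = x ^+ 2 -> ~ (exists y, f y = x) -> irreducible_poly ('X^2 - a%:P).
Proof.
move=> fa nfx; apply: cubic_irreducible; first by rewrite size_XnsubC.
move=> y; apply/negP => /rootP; rewrite !hornerE => /eqP; rewrite subr_eq0 => /eqP.
move=> /(congr1 f); rewrite rmorphXn fa => /eqP; rewrite eqf_sqr => /orP[] /eqP fy.
  by apply: nfx; exists y.
by apply: nfx; exists (- y); rewrite rmorphN fy opprK.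
Qed.

(** * Numbers reached by towers of quadratic extensions of the rationals *)

Section QuadraticTowers.
Variable E : numFieldType.

Definition two_power_dim (L : fieldExtType rat) : Prop :=
  exists m : nat, \dim {:L} = (2 ^ m)%N.

(* Quantifying over every tower that is already built makes closure under the
   field operations immediate: no compositum of two towers is needed. *)
Definition quadratic_over (x : E) : Prop :=
  forall (L : fieldExtType rat) (f : {rmorphism L -> E}), two_power_dim L ->
  exists (L' : fieldExtType rat) (f' : {rmorphism L' -> E}),
    [/\ two_power_dim L', forall y, exists y', f' y' = f y & exists y, f' y = x].

Definition quadratic_pred : {pred E} := [pred x | `[< quadratic_over x >]].

Lemma quadratic_predP x : reflect (quadratic_over x) (x \in quadratic_pred).
Proof. exact: asboolP. Qed.

(** The tower that reaches [x] serves as the starting tower for [y], so a single embedding reaches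
    both. *)
Lemma quadratic_pred_combine (op : E -> E -> E)
    (opL : forall (L : fieldExtType rat) (f : {rmorphism L -> E}) u v,
       exists w, f w = op (f u) (f v)) x y :
  x \in quadratic_pred -> y \in quadratic_pred -> op x y \in quadratic_pred.
Proof.
move=> /quadratic_predP Hx /quadratic_predP Hy; apply/quadratic_predP => L f Ldim.
have [L1 [f1 [L1dim f1f [x1 f1x]]]] := Hx L f Ldim.
have [L2 [f2 [L2dim f2f1 [y2 f2y]]]] := Hy L1 f1 L1dim.
exists L2, f2; split=> // [z|].
  by have [z1 <-] := f1f z; apply: f2f1.
by have [x2 f2x] := f2f1 x1; rewrite -f1x -f2x -f2y; apply: opL.
Qed.

Lemma quadratic_pred_divring_closed : divring_closed quadratic_pred.
Proof.
split.
- apply/quadratic_predP => L f Ldim; exists L, f; split=> // [y|].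
    by exists y.
  by exists 1; rewrite rmorph1.
- move=> x y; apply: (quadratic_pred_combine (op := fun x y => x - y)) => L f u v.
  by exists (u - v); rewrite rmorphB.
- move=> x y; apply: (quadratic_pred_combine (op := fun x y => x / y)) => L f u v.
  by exists (u / v); rewrite fmorph_div.
Qed.

HB.instance Definition _ :=
  GRing.isDivringClosed.Build E quadratic_pred quadratic_pred_divring_closed.

(** Once [x ^+ 2] is the image of some [a], either [x] is already reached, or adjoining a root of
    ['X^2 - a%:P] doubles the degree and reaches it. *)
Lemma quadratic_pred_sqrt (x : E) : x ^+ 2 \in quadratic_pred -> x \in quadratic_pred.
Proof.
move=> /quadratic_predP Hx; apply/quadratic_predP => L f Ldim.
have [L1 [f1 [L1dim f1f [a fa]]]] := Hx L f Ldim.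
have [fx|nfx] := pselect (exists y, f1 y = x); first by exists L1, f1.
have irr := irreducible_sqr_sub fa nfx.
set p := 'X^2 - a%:P in irr.
have px0 : root (map_poly f1 p) x.
  by apply/rootP; rewrite rmorphB /= map_polyXn map_polyC /= !hornerE fa subrr.
pose M : fieldExtType L1 := SubFieldExtType px0 irr.
pose g : {rmorphism M -> E} := @subfx_inj _ _ f1 x p.
exists (baseFieldType M), (g : {rmorphism baseFieldType M -> E}); split.
- have [m dimL1] := L1dim; exists m.+1.
  rewrite dim_baseFieldType dimL1 expnS dimvf; congr (_ * _)%N.
  (* By construction [M] has degree [(size p).-1], that is 2, over [L1]. *)
  by rewrite (_ : dim M = (size p).-1) // size_XnsubC.
- move=> y; have [y1 <-] := f1f y; exists (y1%:A : M).
  exact: (subfx_inj_base px0 (irredp_neq0 irr)).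
- exists (subfx_root f1 x p); exact: (subfx_inj_root px0 (irredp_neq0 irr)).
Qed.

(** The tower is started at the rationals themselves, of degree [2 ^ 0]. *)
Lemma quadratic_pred_embedding (x : E) : x \in quadratic_pred ->
  exists (L : fieldExtType rat) (f : {rmorphism L -> E}) (y : L),
    two_power_dim L /\ f y = x.
Proof.
move=> /quadratic_predP Hx.
have Qdim : two_power_dim (rat^o : fieldExtType rat).
  by exists 0%N; rewrite dimvf.
have [L [f [Ldim _ [y fy]]]] := Hx rat^o (ratr : {rmorphism rat^o -> E}) Qdim.
by exists L, f, y.
Qed.

End QuadraticTowers.

(** * Cyclotomic polynomials and degrees of cyclotomic extensions *)

Lemma cyclotomic_rat_irreducible n : (0 < n)%N ->
  irreducible_poly (map_poly intr 'Phi_n : {poly rat}).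
Proof.
move=> n_gt0; have [w prim_w] := C_prim_root_exists n_gt0.
have [p [minwE p_monic] root_wE] := minCpolyP w.
(* Both sides become the minimal polynomial of [w] in [algC]. *)
have -> : map_poly intr 'Phi_n = p.
  apply: (map_inj_poly (fmorph_inj (ratr : rat -> algC))); first by rewrite rmorph0.
  rewrite -minwE (minCpoly_cyclotomic prim_w) -(Cintr_Cyclotomic prim_w).
  by rewrite -map_poly_comp; apply: eq_map_poly => k; rewrite /= rmorph_int.
have pw0 : root (map_poly ratr p) w by rewrite root_wE.
(* A nonzero rational polynomial vanishing at [w] is a multiple of [p], hence not smaller; this
   minimality gives irreducibility. *)
apply/(subfx_irreducibleP pw0 (monic_neq0 p_monic)) => q qw0 q_neq0.
by rewrite dvdp_leq // -root_wE.
Qed.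

(** ['X^n - 1] is the product of the ['Phi_d] with [d] dividing [n], so some ['Phi_d] vanishes at
    [z]; then [z ^+ d = 1], and the order [n] of [z] divides [d]. *)
Lemma root_map_Cyclotomic (F : fieldType) n (z : F) :
  n.-primitive_root z -> root (map_poly intr 'Phi_n) z.
Proof.
move=> prim_z; have n_gt0 := prim_order_gt0 prim_z.
have map_Xn1 d : map_poly intr ('X^d - 1 : {poly int}) = 'X^d - 1 :> {poly F}.
  by rewrite rmorphB /= map_polyXn rmorph1.
have /eqP : (map_poly intr ('X^n - 1 : {poly int}) : {poly F}).[z] = 0.
  by rewrite map_Xn1 !hornerE (prim_expr_order prim_z) subrr.
rewrite -(prod_Cyclotomic n_gt0) rmorph_prod horner_prod prodf_seq_eq0.
move=> /hasP[d]; rewrite -dvdn_divisors // => d_dvd_n /= /eqP Phi_d_z.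
have d_gt0 : (0 < d)%N := dvdn_gt0 n_gt0 d_dvd_n.
suff -> : n = d by apply/rootP.
apply/eqP; rewrite eqn_dvd d_dvd_n andbT (prim_order_dvd prim_z).
rewrite -subr_eq0 -[z ^+ d - 1](_ : ('X^d - 1).[z] = _); last by rewrite !hornerE.
rewrite -map_Xn1 -(prod_Cyclotomic d_gt0) (big_rem d) /=; last by rewrite -dvdn_divisors.
by rewrite rmorphM hornerM Phi_d_z mul0r.
Qed.

(** The minimal polynomial of [z] over the rationals divides the irreducible ['Phi_n], so the two
    are associates and have equal degree. *)
Lemma dim_cyclotomic_ext (L : fieldExtType rat) n (z : L) :
  n.-primitive_root z -> \dim <<1; z>> = totient n.
Proof.
move=> prim_z; have n_gt0 := prim_order_gt0 prim_z.
pose q : {poly rat} := map_poly intr 'Phi_n.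
have size_q : size q = (totient n).+1.
  rewrite size_map_inj_poly ?size_Cyclotomic //; exact: intr_inj.
have [p minzE] : exists p : {poly rat}, minPoly 1 z = map_poly (in_alg L) p.
  by have /polyOver1P := minPolyOver 1 z.
have p_dvd_q : p %| q.
  rewrite -(dvdp_map (in_alg L)) -minzE minPoly_dvdp //.
    by apply/polyOver1P; exists q.
  rewrite -map_poly_comp (_ : map_poly _ _ = map_poly intr 'Phi_n).
    exact: root_map_Cyclotomic.
  by apply: eq_map_poly => k; rewrite /= scaler_int.
have size_p : size p = (\dim <<1; z>>).+1.
  by rewrite dim_Fadjoin dimv1 muln1 -size_minPoly minzE size_map_poly.
have p_eqp_q : p %= q.
  apply: (cyclotomic_rat_irreducible n_gt0).2 => //.
  by rewrite size_p eqSS -lt0n adim_gt0.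
by apply/eqP; rewrite -eqSS -size_p -size_q (eqp_size p_eqp_q).
Qed.

(** A prime with exponent [k > 0] in [n] has exponent at least [2 * k - 1 >= k] in the totient of
    [n ^ 2]. *)
Lemma dvdn_totient_sqr n : (0 < n)%N -> (n %| totient (n ^ 2))%N.
Proof.
move=> n_gt0; rewrite totientE ?expn_gt0 ?n_gt0 // primesX //.
rewrite [X in (X %| _)%N](prod_prime_decomp n_gt0) prime_decompE big_map /=.
elim/big_ind2: _ => // [a b c d|p _]; first exact: dvdn_mul.
rewrite dvdn_mull // /pfactor /= lognX dvdn_exp2l //.
by case: (logn p n) => //= k; lia.
Qed.

(** * Intersections of lines and circles with coefficients in a subfield *)

Local Ltac in_field := repeat first [assumption | apply: rpred_nat | apply: rpredX
  | apply: rpred_div | apply: rpredM | apply: rpredB | apply: rpredD | rewrite rpredN].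

Section PlaneCurves.
Local Open Scope classical_set_scope.
Variables (R : realFieldType) (P : divringClosed R).
Hypothesis P_sqrt : forall x : R, x ^+ 2 \in P -> x \in P.

Definition line_curve (a b c : R) : set (R * R) :=
  [set x | a * x.1 + b * x.2 = c].

Definition circle_curve (a b c : R) : set (R * R) :=
  [set x | x.1 ^+ 2 + x.2 ^+ 2 + a * x.1 + b * x.2 = c].

(** The inequation keeps [a] and [b] from both vanishing, which excludes the empty set and the whole
    plane as lines. *)
Definition curve_over (A : set (R * R)) : Prop :=
  exists a b c : R, [/\ a \in P, b \in P, c \in P &
    (A = line_curve a b c /\ a ^+ 2 + b ^+ 2 != 0) \/ A = circle_curve a b c].

Definition point_over (x : R * R) : Prop := x.1 \in P /\ x.2 \in P.

Lemma line_curve_sub (a1 b1 c1 a2 b2 c2 : R) x :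
  a1 ^+ 2 + b1 ^+ 2 != 0 -> a1 * b2 = a2 * b1 ->
  line_curve a1 b1 c1 x -> line_curve a2 b2 c2 x ->
  line_curve a1 b1 c1 `<=` line_curve a2 b2 c2.
Proof.
rewrite /line_curve /= => N1 det0 x1 x2 y /= y1.
apply: (mulfI N1); rewrite -x2; apply/eqP; rewrite -subr_eq0; apply/eqP => /=.
(* The scalar product of [(a2, b2)] and [y - x] is expanded along [(a1, b1)] and its perpendicular.
   One term vanishes because [x] and [y] lie on the first line, the other because the normals are
   parallel. *)
transitivity ((a1 * a2 + b1 * b2) * ((a1 * y.1 + b1 * y.2) - (a1 * x.1 + b1 * x.2))
  + (a1 * b2 - a2 * b1) * (a1 * (y.2 - x.2) - b1 * (y.1 - x.1))); first by ring.
by rewrite y1 x1 det0 !subrr mul0r mulr0 addr0.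
Qed.

(** Parallel lines with a common point coincide; otherwise Cramer's rule gives the coordinates. *)
Lemma meet_line_line (a1 b1 c1 a2 b2 c2 : R) x :
  a1 \in P -> b1 \in P -> c1 \in P -> a2 \in P -> b2 \in P -> c2 \in P ->
  a1 ^+ 2 + b1 ^+ 2 != 0 -> a2 ^+ 2 + b2 ^+ 2 != 0 ->
  line_curve a1 b1 c1 <> line_curve a2 b2 c2 ->
  line_curve a1 b1 c1 x -> line_curve a2 b2 c2 x -> point_over x.
Proof.
move=> Pa1 Pb1 Pc1 Pa2 Pb2 Pc2 N1 N2 neq x1 x2.
have [det0|det_neq0] := eqVneq (a1 * b2) (a2 * b1).
  case: neq; apply/seteqP; split; first exact: line_curve_sub x1 x2.
  by apply: line_curve_sub x2 x1 => //; rewrite det0.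
have D_neq0 : a1 * b2 - a2 * b1 != 0 by rewrite subr_eq0.
move: x1 x2; rewrite /line_curve /= => x1 x2; split.
  have -> : x.1 = (c1 * b2 - c2 * b1) / (a1 * b2 - a2 * b1).
    by apply: (mulIf D_neq0); rewrite divfK // -x1 -x2; ring.
  by in_field.
have -> : x.2 = (a1 * c2 - a2 * c1) / (a1 * b2 - a2 * b1).
  by apply: (mulIf D_neq0); rewrite divfK // -x1 -x2; ring.
by in_field.
Qed.

(** The point is recovered from its scalar products [c1] with the normal [(a1, b1)] and [s] with the
    direction [(b1, - a1)] of the line. Completing the square shows that [2 * s + e] is a square
    root of a discriminant in [P]. *)
Lemma meet_line_circle (a1 b1 c1 a2 b2 c2 : R) x :
  a1 \in P -> b1 \in P -> c1 \in P -> a2 \in P -> b2 \in P -> c2 \in P ->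
  a1 ^+ 2 + b1 ^+ 2 != 0 ->
  line_curve a1 b1 c1 x -> circle_curve a2 b2 c2 x -> point_over x.
Proof.
move=> Pa1 Pb1 Pc1 Pa2 Pb2 Pc2; set N := _ + _ => N_neq0.
rewrite /line_curve /circle_curve /= => x1 x2.
pose s := b1 * x.1 - a1 * x.2; pose e := a2 * b1 - b2 * a1.
have PN : N \in P by in_field.
have Pe : e \in P by in_field.
have Ps : s \in P.
  (* s is a root of X^2 + e X + (c1^2 + (a2 a1 + b2 b1) c1 - c2 N). *)
  have P2 : 2%:R \in P by rewrite rpred_nat.
  have -> : s = ((2 * s + e) - e) / 2 by field.
  apply: rpred_div => //; apply: rpredB => //; apply: P_sqrt.
  have -> : (2 * s + e) ^+ 2
      = e ^+ 2 - 4%:R * (c1 ^+ 2 + a2 * a1 * c1 + b2 * b1 * c1 - c2 * N).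
    by rewrite -x1 -x2 /e /s /N; ring.
  by in_field.
split.
  have -> : x.1 = (a1 * c1 + b1 * s) / N.
    by apply: (mulIf N_neq0); rewrite divfK // -x1 /s /N; ring.
  by in_field.
have -> : x.2 = (b1 * c1 - a1 * s) / N.
  by apply: (mulIf N_neq0); rewrite divfK // -x1 /s /N; ring.
by in_field.
Qed.

(** Subtracting the equations gives the radical line, which reduces to a line and a circle. If it
    degenerates, the circles are concentric, and their common point makes them equal. *)
Lemma meet_circle_circle (a1 b1 c1 a2 b2 c2 : R) x :
  a1 \in P -> b1 \in P -> c1 \in P -> a2 \in P -> b2 \in P -> c2 \in P ->
  circle_curve a1 b1 c1 <> circle_curve a2 b2 c2 ->
  circle_curve a1 b1 c1 x -> circle_curve a2 b2 c2 x -> point_over x.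
Proof.
move=> Pa1 Pb1 Pc1 Pa2 Pb2 Pc2 neq x1 x2.
have radical : line_curve (a1 - a2) (b1 - b2) (c1 - c2) x.
  by move: x1 x2; rewrite /line_curve /circle_curve /= => <- <-; ring.
have [N0|N_neq0] := eqVneq ((a1 - a2) ^+ 2 + (b1 - b2) ^+ 2) 0; last first.
  by apply: (meet_line_circle _ _ _ Pa1 Pb1 Pc1 N_neq0 radical x1); rewrite rpredB.
move/eqP: N0; rewrite paddr_eq0 ?sqr_ge0 // !sqrf_eq0 !subr_eq0 => /andP[/eqP ea /eqP eb].
by case: neq; rewrite -x1 -x2 ea eb.
Qed.

Lemma meet_curve_over A B x :
  curve_over A -> curve_over B -> A <> B -> A x -> B x -> point_over x.
Proof.
move=> [a1 [b1 [c1 [Pa1 Pb1 Pc1 HA]]]] [a2 [b2 [c2 [Pa2 Pb2 Pc2 HB]]]].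
case: HA => [[-> N1]|->]; case: HB => [[-> N2]|->].
- exact: meet_line_line.
- by move=> _; apply: meet_line_circle.
- by move=> _ x1 x2; apply: (meet_line_circle _ _ _ _ _ _ N2 x2 x1).
- exact: meet_circle_circle.
Qed.

End PlaneCurves.

(** * Constructible points over a subfield closed under square roots *)

Section ConstructibleOver.
Local Open Scope classical_set_scope.
Variables (R : realType) (P : divringClosed R).
Hypothesis P_sqrt : forall x : R, x ^+ 2 \in P -> x \in P.

Lemma line_through_over p q :
  point_over P p -> point_over P q -> p <> q -> curve_over P (line_through p q).
Proof.
case: p q => [p1 p2] [q1 q2] [/= Pp1 Pp2] [/= Pq1 Pq2] neq.
have N_neq0 : (q2 - p2) ^+ 2 + (p1 - q1) ^+ 2 != 0.
  apply: contra_notN neq; rewrite paddr_eq0 ?sqr_ge0 // !sqrf_eq0 !subr_eq0.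
  by move=> /andP[/eqP-> /eqP->].
exists (q2 - p2), (p1 - q1), (p1 * q2 - p2 * q1).
split; try by in_field.
left; split=> //.
apply/seteqP; split=> [_ [t ->]|[x y]]; rewrite /line_curve /=; first by ring.
(* The parameter is that of the orthogonal projection of [(x, y)] onto the line. *)
move=> xy; exists (((x - p1) * (q1 - p1) + (y - p2) * (q2 - p2))
  / ((q2 - p2) ^+ 2 + (p1 - q1) ^+ 2)).
have dir : (q2 - p2) * (x - p1) - (q1 - p1) * (y - p2) = 0.
  by move/eqP: xy; rewrite -subr_eq0 => /eqP xy; rewrite -[RHS]xy; ring.
congr pair; apply: (mulIf N_neq0); rewrite mulrDl mulrAC divfK //; apply/eqP;
  rewrite -subr_eq0; apply/eqP => /=.
  transitivity ((q2 - p2) * ((q2 - p2) * (x - p1) - (q1 - p1) * (y - p2))); first by ring.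
  by rewrite dir mulr0.
transitivity ((p1 - q1) * ((q2 - p2) * (x - p1) - (q1 - p1) * (y - p2))); first by ring.
by rewrite dir mulr0.
Qed.

Lemma circle_centered_over p q :
  point_over P p -> point_over P q -> curve_over P (circle_centered p q).
Proof.
case: p q => [p1 p2] [q1 q2] [/= Pp1 Pp2] [/= Pq1 Pq2].
exists (- (2%:R * p1)), (- (2%:R * p2)),
  (q1 ^+ 2 + q2 ^+ 2 - 2%:R * p1 * q1 - 2%:R * p2 * q2).
split; try by in_field.
right.
by apply/seteqP; split=> -[x y]; rewrite /circle_centered /circle_curve /sqdist /= => xy;
  lra.
Qed.

Scheme constructible_drawn_ind := Minimality for constructible Sort Prop
  with drawn_constructible_ind := Minimality for drawn Sort Prop.

(** Simultaneous induction: points keep their coordinates in [P], drawn curves their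
    coefficients. *)
Lemma constructible_over (S : set (R * R)) :
  (forall x, S x -> point_over P x) -> forall x, constructible S x -> point_over P x.
Proof.
move=> S_over x; apply: (constructible_drawn_ind (P0 := curve_over P)) => //.
- by move=> A B y _ A_over _ B_over; apply: (meet_curve_over P_sqrt).
- by move=> p q _ p_over _ q_over; apply: line_through_over.
- by move=> c q _ c_over _ q_over _; apply: circle_centered_over.
Qed.

End ConstructibleOver.

(** * Angles and roots of unity *)

Section Angles.
Variable R : realType.

(** Towers are embedded in [R[i]] rather than [R], since the root of unity formed from cosine and
    sine lives there. *)
Definition real_quadratic : {pred R} := [pred x | x%:C%C \in @quadratic_pred R[i]].

Lemma real_quadraticE x :
  (x \in real_quadratic) = (x%:C%C \in @quadratic_pred R[i]).
Proof. by []. Qed.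

Lemma real_quadratic_divring_closed : divring_closed real_quadratic.
Proof.
split=> [|x y|x y]; rewrite !real_quadraticE.
- by rewrite rmorph1 rpred1.
- by rewrite rmorphB; apply: rpredB.
- by rewrite fmorph_div; apply: rpred_div.
Qed.

HB.instance Definition _ :=
  GRing.isDivringClosed.Build R real_quadratic real_quadratic_divring_closed.

Lemma real_quadratic_sqrt (x : R) : x ^+ 2 \in real_quadratic -> x \in real_quadratic.
Proof. by rewrite !real_quadraticE rmorphXn; apply: quadratic_pred_sqrt. Qed.

Lemma sectable_real_quadratic n (alpha : R) : sectable n alpha ->
  cos alpha \in real_quadratic -> sin alpha \in real_quadratic ->
  cos (alpha / n%:R) \in real_quadratic /\ sin (alpha / n%:R) \in real_quadratic.
Proof.
move=> n_sect Qcos Qsin; apply: (constructible_over real_quadratic_sqrt _ n_sect).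
by move=> _ [[]|] ->; split => //=; rewrite ?rpred0 ?rpred1.
Qed.

Definition cis (x : R) : R[i] := Complex (cos x) (sin x).

Lemma cisX x k : cis x ^+ k = cis (x *+ k).
Proof.
elim: k => [|k IHk]; first by rewrite mulr0n /cis cos0 sin0.
rewrite exprS IHk mulrS /cis cosD sinD; apply/eqP.
by rewrite eq_complex /= eqxx addrC eqxx.
Qed.

Lemma cos_lt1 (x : R) : 0 < x < pi *+ 2 -> cos x < 1.
Proof.
move=> /andP[x_gt0 x_lt2pi].
have -> : x = (x / 2) *+ 2 by lra.
have : 0 < sin (x / 2) by apply: sin_gt0_pi; lra.
rewrite cos_mulr2n cos2sin2 => sin_gt0.
have : 0 < sin (x / 2) ^+ 2 by apply: exprn_gt0.
by lra.
Qed.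

(** If the order [m] were less than [n], the angle [2 pi m / n] would lie strictly between 0 and
    [2 pi] and still have cosine 1. *)
Lemma cis_primitive_root n : (0 < n)%N -> n.-primitive_root (cis (pi *+ 2 / n%:R)).
Proof.
move=> n_gt0; have n_neq0 : n%:R != 0 :> R by rewrite pnatr_eq0 -lt0n.
have cis_n : cis (pi *+ 2 / n%:R) ^+ n = 1.
  by rewrite cisX -[_ *+ n]mulr_natr divfK // /cis cos2pi sin2pi.
have [m prim_m m_dvd_n] := prim_order_exists n_gt0 cis_n.
have m_gt0 := prim_order_gt0 prim_m.
have [m_eq_n|m_neq_n] := eqVneq m n; first by rewrite {1}m_eq_n in prim_m.
have m_lt_n : (m < n)%N by rewrite ltn_neqAle m_neq_n dvdn_leq.
have /(congr1 (@complex.Re R)) /= := prim_expr_order prim_m.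
rewrite cisX /= => cos1; suff : cos (pi *+ 2 / n%:R *+ m) < 1 :> R by rewrite cos1 ltxx.
have twopi_gt0 : 0 < pi *+ 2 :> R by rewrite pmulrn_lgt0 ?pi_gt0.
apply: cos_lt1; rewrite pmulrn_lgt0 // divr_gt0 ?ltr0n //=.
by rewrite -[_ *+ m]mulr_natr mulrAC ltr_pdivrMr ?ltr0n // ltr_pM2l ?ltr_nat.
Qed.

(** The imaginary unit is itself quadratic, as a square root of -1. *)
Lemma cis_quadratic (x : R) :
  cos x \in real_quadratic -> sin x \in real_quadratic -> cis x \in @quadratic_pred R[i].
Proof.
rewrite !real_quadraticE => Qcos Qsin.
have -> : cis x = (cos x)%:C%C + Complex 0 1 * (sin x)%:C%C by rewrite /cis; simpc.
rewrite rpredD // rpredM //; apply: quadratic_pred_sqrt.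
have -> : Complex 0 1 ^+ 2 = -1 :> R[i] by rewrite sqr_i.
by rewrite rpredN rpred1.
Qed.

End Angles.

Theorem theoremA1 (R : realType) (n : nat) (n_gt0 : (0 < n)%N)
  (n_sectable : forall alpha : R, sectable n alpha) :
  exists k : nat, n = (2 ^ k)%N.
Proof.
(* The full turn has rational cosine and sine, so it can be divided first, and then the resulting
   angle. *)
have [Qcos1 Qsin1] : cos (pi *+ 2 / n%:R) \in @real_quadratic R /\
    sin (pi *+ 2 / n%:R) \in @real_quadratic R.
  by apply: sectable_real_quadratic => //; rewrite ?cos2pi ?sin2pi ?rpred1 ?rpred0.
have [] := sectable_real_quadratic (n_sectable (pi *+ 2 / n%:R)) Qcos1 Qsin1.
rewrite -mulrA -invfM -natrM => Qcos2 Qsin2.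
have [L [f [z [[m dimL] fz]]]] :=
  quadratic_pred_embedding (cis_quadratic Qcos2 Qsin2).
have prim_z : (n * n).-primitive_root z.
  by rewrite -(fmorph_primitive_root f) fz cis_primitive_root // muln_gt0 n_gt0.
(* [n] divides [totient (n ^ 2)], the degree of the subfield generated by [z], which divides the
   degree [2 ^ m] of [L]. *)
have : (n %| 2 ^ m)%N.
  rewrite (dvdn_trans (dvdn_totient_sqr n_gt0)) // -mulnn.
  by rewrite -(dim_cyclotomic_ext prim_z) -dimL field_dimS ?subvf.
by move=> /(dvdn_pfactor _ _ (isT : prime 2))[k _ ->]; exists k.
Qed.
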